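(* Let $\theta_1,\theta_2\in\mathbb{R}$ and assume $\theta_1\notin\mathbb{Z}$ or $\theta_2\notin\mathbb{Z}$. Then there is a dense set of $(\xi,\zeta)\in\mathbb{R}^2$ (dense in $\mathbb{R}^2$), of Hausdorff dimension at least $1$, each of whose elements satisfies $$\liminf_{Q\to\infty}\, Q \min_{q\in \mathbb{Z},\, 0<q\le Q} \Vert q\xi-\theta_1\Vert\cdot \Vert q \zeta-\theta_2\Vert \;=\; \liminf_{q\to\infty}\, q\, \Vert q\xi-\theta_1\Vert\cdot \Vert q \zeta-\theta_2\Vert \;>\; 0.$$
   Context: $\Vert x\Vert$ denotes the distance from the real number $x$ to the nearest integer. In $\liminf_{Q\to\infty}$ and $\liminf_{q\to\infty}$ the variables $Q$ and $q$ run through the positive integers; lower limits are taken in $[0,\infty]$. *)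

(* Defs.v *)
From HB Require Import structures.
From mathcomp Require Import all_boot all_order all_algebra.
From mathcomp Require Import all_classical all_reals all_analysis.

Set Implicit Arguments.
Unset Strict Implicit.
Unset Printing Implicit Defensive.

Import Order.TTheory GRing.Theory Num.Theory.
Import numFieldNormedType.Exports.

Local Open Scope classical_set_scope.
Local Open Scope ring_scope.

Definition dist_int (R : realType) (x : R) : R :=
  inf [set `|x - n%:~R| | n in [set: int]].

Definition mult_form (R : realType) (theta1 theta2 xi zeta : R) (q : nat) : R :=
  dist_int (q%:R * xi - theta1) * dist_int (q%:R * zeta - theta2).

(* The shift makes the index run through 1, 2, 3, ... *)
Definition liminf_pos (R : realType) (u : nat -> \bar R) : \bar R :=
  limn_einf (fun n => u n.+1).

(* The neutral element +oo is never attained when 0 < Q. *)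
Definition min_upto (R : realType) (f : nat -> R) (Q : nat) : \bar R :=
  (\big[mine/+oo]_(1 <= q < Q.+1) (f q)%:E)%E.

(* The norm of R * R in the library is the sup norm, hence this definition. *)
Definition dist2 (R : realType) (p q : R * R) : R :=
  Num.sqrt ((p.1 - q.1) ^+ 2 + (p.2 - q.2) ^+ 2).

Section Hausdorff.
Context {R : realType} {T : Type} (d : T -> T -> R).
Local Open Scope ereal_scope.

(* The maximum with 0 gives the empty set diameter 0 instead of -oo. *)
Definition diam (A : set T) : \bar R :=
  maxe 0 (ereal_sup [set (d x y)%:E | x in A & y in A]).

(* Since x `^ 0 = 1 also for x = 0, the empty set is treated separately, so
   that padding a cover with empty sets costs nothing even when s = 0. *)
Definition hausdorff_weight (s : R) (A : set T) : \bar R :=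
  if A == set0 then 0 else diam A `^ s.

Definition hausdorff_content (s delta : R) (A : set T) : \bar R :=
  ereal_inf [set \sum_(0 <= i <oo) hausdorff_weight s (F i) |
    F in [set F : nat -> set T |
      A `<=` \bigcup_i F i /\ forall i, diam (F i) <= delta%:E]].

Definition hausdorff_measure (s : R) (A : set T) : \bar R :=
  ereal_sup [set hausdorff_content s delta A |
    delta in [set delta : R | (0 < delta)%R]].

Definition hausdorff_dim (A : set T) : \bar R :=
  ereal_inf [set s%:E |
    s in [set s : R | (0 <= s)%R /\ hausdorff_measure s A = 0]].

End Hausdorff.

(* Main.v *)
Require Import Defs.
From HB Require Import structures.
From mathcomp Require Import all_boot all_order all_algebra.
From mathcomp Require Import all_classical all_reals all_analysis.
From mathcomp Require Import ring lra zify.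

Set Implicit Arguments.
Unset Strict Implicit.
Unset Printing Implicit Defensive.

Import Order.TTheory GRing.Theory Num.Theory.
Import numFieldNormedType.Exports.

Local Open Scope classical_set_scope.
Local Open Scope ring_scope.

(** Suppose theta2 is not an integer. A rational zeta = a/b for which b * theta2
    is not an integer keeps ||q zeta - theta2|| away from 0 uniformly in q,
    because the fractional part of b * (q zeta - theta2) does not depend on q.
    Such rationals are dense: b and b.+1 cannot both fail. Over such a zeta it
    suffices to take xi with ||q xi - theta1|| >= c / q for all q >= 1
    ([inhom_bad]). The product q ||q xi - theta1|| ||q zeta - theta2|| is then
    bounded below by a positive constant, and this lower bound alone makes the
    two lower limits agree ([limn_einf_min_upto]): where the minimum over q <= Q
    is attained at a q that is small compared with Q, Q times the minimum is
    large, and elsewhere q itself is large and Q times the minimum is at least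
    q ||q xi - theta1|| ||q zeta - theta2||. The case of theta1 is symmetric.

    It remains to see that, for every theta, the set of [inhom_bad] numbers is
    dense and has dimension at least 1. Both follow from one nested interval
    construction ([exists_inhom_bad_avoiding]). An interval of stage n has
    length 1 / (2 K^(2n+2)); of its K^2 equal parts every second one is a
    candidate for the next stage. At each stage two kinds of candidates are
    dangerous.
    - Those with a point x such that |x - p/q| < c / q^2 where
      K^n <= q < K^(n+1). Two distinct rationals with such denominators are too
      far apart, so that at most one candidate is lost ([hom_approx_close]).
    - Those with a point x such that |x - (p + theta)/q| < c' / q^2 where
      K^n <= q K^3 < K^(n+1). The points (p + theta)/q need not be well spaced,
      but two of them, with different q, near x would make x close to a
      rational with denominator smaller than K^n, which earlier stages have
      excluded; the delay K^3 is what makes this work. Again at most one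
      candidate is lost ([inhom_approx_close]).

    For the dimension, let a cover of small s-dimensional weight be given. The
    construction also keeps the total weight of the sets of the cover that meet
    the current interval below lam^n, where 1/lam = K^2/2 - 2 is a lower bound
    for the number of safe candidates. As s < 1, for large K the ratio lam is
    at most the s-th power of the ratio of successive lengths, so that this
    bound forces those sets to be shorter than the gaps between the candidates.
    Hence each meets at most one candidate, and averaging over the safe
    candidates yields one which satisfies the bound for n + 1
    ([exists_light_child]). A set that contains the limit point would have
    weight below every lam^n, which positive weights exclude; so the cover
    misses an [inhom_bad] number. *)

(** * Spacing of good approximations *)

Section Approx.
Variable R : realType.
Implicit Types (x y th : R) (q K n : nat) (p : int).

(** The length of the stage n intervals; it is at most half the distance
    of two distinct fractions with denominators below K^(n+1). *)
Definition stage_len K n : R := (2 * K%:R ^+ (n.*2.+2))^-1.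

Lemma int_norm_lt1_eq0 (z : int) : `|z%:~R : R| < 1 -> z = 0.
Proof.
by rewrite -intr_norm -[1]/(1%:~R) ltr_int => h; apply/eqP; rewrite -absz_eq0; lia.
Qed.

(** The approximation constants are chosen so that two points of one interval
    of stage n that are this close to the same fraction are closer to each other
    than the length of stage n.+1; [inhom_c] is smaller because the denominators
    in question are smaller by the factor K^3. *)
Definition hom_c K : R := (4 * K%:R ^+ 5)^-1.
Definition inhom_c K : R := (4 * K%:R ^+ 10)^-1.

Lemma stage_lenE K n : stage_len K n = (2 * (K%:R ^+ n) ^+ 2 * K%:R ^+ 2)^-1.
Proof. by rewrite /stage_len -muln2 -[(n * 2).+2]addn2 exprD exprM mulrA. Qed.

Lemma stage_lenS K n : (0 < K)%N -> stage_len K n = K%:R ^+ 2 * stage_len K n.+1.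
Proof.
move=> K0; rewrite /stage_len doubleS.
have : K%:R != 0 :> R by rewrite pnatr_eq0 -lt0n.
by rewrite !exprS; move=> h; field; rewrite h expf_neq0.
Qed.

Lemma stage_len_gt0 K n : (0 < K)%N -> 0 < stage_len K n.
Proof. by move=> K0; rewrite invr_gt0 mulr_gt0 ?exprn_gt0 ?ltr0n. Qed.

(** The integer p q' - p' q has absolute value less than 1: both errors
    contribute at most K times the constant, and the distance between x and x'
    at most 1/2. So p / q = p' / q' and both points are close to it. *)
Lemma hom_approx_close K n q q' p p' x x' : (2 <= K)%N ->
  (K ^ n <= q < K ^ n.+1)%N -> (K ^ n <= q' < K ^ n.+1)%N ->
  `|x - x'| <= stage_len K n ->
  q%:R * `|q%:R * x - p%:~R| < hom_c K ->
  q'%:R * `|q'%:R * x' - p'%:~R| < hom_c K ->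
  `|x - x'| < stage_len K n.+1.
Proof.
move=> K2 /andP[q1 q2] /andP[q1' q2'] xx h h'.
have K0 : (0 < K)%N by lia.
set k : R := K%:R.
have k2 : 2 <= k by rewrite ler_nat.
have kn0 : k != 0 by rewrite gt_eqF //; lra.
have c0E : k ^+ 5 * hom_c K = 1 / 4.
  by rewrite /hom_c -/k; field.
have LE : k ^+ n.*2.+2 * stage_len K n = 1 / 2.
  by rewrite /stage_len -/k; field; rewrite ?expf_neq0.
have Qn (u v : nat) : (K ^ n <= u)%N -> (v < K ^ n.+1)%N -> v%:R <= k * u%:R.
  move=> h1 h2; rewrite -natrM ler_nat.
  by apply: (leq_trans (ltnW h2)); rewrite expnS leq_mul2l h1 orbT.
have nq := Qn _ _ q1 q2'. have nq' := Qn _ _ q1' q2.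
have ub : q%:R * q'%:R <= k ^+ n.*2.+2.
  rewrite -natrM -natrX ler_nat (_ : n.*2.+2 = n.+1 + n.+1)%N; last by lia.
  by rewrite expnD leq_mul // ltnW.
have lb : k ^+ n.*2 <= q%:R * q'%:R.
  by rewrite -natrM -natrX ler_nat -addnn expnD leq_mul.
set A := q%:R * x - p%:~R in h.
set A' := q'%:R * x' - p'%:~R in h'.
have e : (p * q' - p' * q)%:~R = q%:R * q'%:R * (x - x') - q'%:R * A + q%:R * A'.
  rewrite /A /A' !(rmorphB, rmorphM) /= -!pmulrn; ring.
have b1 : `|q'%:R * A| < k * hom_c K.
  rewrite normrM normr_nat; apply: (@le_lt_trans _ _ (k * (q%:R * `|A|))).
    by rewrite mulrA ler_wpM2r.
  by rewrite ltr_pM2l // /k ltr0n.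
have b2 : `|q%:R * A'| < k * hom_c K.
  rewrite normrM normr_nat; apply: (@le_lt_trans _ _ (k * (q'%:R * `|A'|))).
    by rewrite mulrA ler_wpM2r.
  by rewrite ltr_pM2l // /k ltr0n.
have b3 : `|q%:R * q'%:R * (x - x')| <= 1 / 2.
  rewrite normrM -[X in X * _]normr_id -LE.
  by rewrite normr_id (@ger0_norm _ (_ * _)) ?mulr_ge0 // ler_pM ?mulr_ge0.
have c0s : k * hom_c K <= 1 / 4 * (k ^+ 4)^-1.
  rewrite -c0E.
  by rewrite le_eqVlt; apply/orP; left; apply/eqP; field.
have k4 : (k ^+ 4)^-1 <= 1.
  by rewrite invf_le1 ?exprn_gt0 ?exprn_ege1 //; lra.
have z : p * q' - p' * q = 0.
  apply: int_norm_lt1_eq0; rewrite e.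
  apply: (le_lt_trans (ler_normD _ _)).
  have := ler_normB (q%:R * q'%:R * (x - x')) (q'%:R * A); lra.
rewrite z in e.
have {}e : q%:R * q'%:R * (x - x') = q'%:R * A - q%:R * A' by move: e; rewrite /=; lra.
have b : q%:R * q'%:R * `|x - x'| < 1 / 2 * (k ^+ 4)^-1.
  rewrite -[q%:R * q'%:R]ger0_norm ?mulr_ge0 // -normrM e.
  apply: (le_lt_trans (ler_normB _ _)); lra.
have kp : 0 < k ^+ n.*2 by rewrite exprn_gt0 //; lra.
rewrite -(ltr_pM2l kp); apply: (le_lt_trans (ler_wpM2r (normr_ge0 _) lb)).
apply: (lt_le_trans b); rewrite stage_lenE -/k -muln2 exprM (exprS k n).
have Nn0 : k ^+ n != 0 by rewrite expf_neq0.
move: (k ^+ n) Nn0 => N Nn0.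
by rewrite le_eqVlt; apply/orP; left; apply/eqP; field; rewrite Nn0 kn0.
Qed.

(** Subtracting the two approximations cancels th and yields an approximation
    of x with denominator q - q', which is better than the assumption on x
    permits unless q = q'. In that case p = p' as well, and both points are
    close to (p + th) / q. *)
Lemma inhom_approx_close K n q q' p p' th x x' : (4 <= K)%N ->
  (K ^ n <= q * K ^ 3 < K ^ n.+1)%N -> (K ^ n <= q' * K ^ 3 < K ^ n.+1)%N ->
  `|x - x'| <= stage_len K n ->
  (forall (q : nat) p, (0 < q < K ^ n)%N -> hom_c K <= q%:R * `|q%:R * x - p%:~R|) ->
  (q' <= q)%N ->
  q%:R * `|q%:R * x - th - p%:~R| < inhom_c K ->
  q'%:R * `|q'%:R * x' - th - p'%:~R| < inhom_c K ->
  `|x - x'| < stage_len K n.+1.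
Proof.
move=> K4 /andP[q1 q2] /andP[q1' q2'] xx hom le h h'.
set k : R := K%:R.
have k4 : 4 <= k by rewrite ler_nat.
have k0 : 0 < k by lra.
have kn0 : k != 0 by rewrite gt_eqF.
set N : R := k ^+ n.
have N1 : 1 <= N by rewrite exprn_ege1 //; lra.
have N0 : 0 < N by lra.
have Nn0 : N != 0 by rewrite gt_eqF.
have lb (u : nat) : (K ^ n <= u * K ^ 3)%N -> N / k ^+ 3 <= u%:R.
  by move=> hu; rewrite ler_pdivrMr ?exprn_gt0 // /N /k -!natrX -natrM ler_nat.
have ubn (u : nat) : (u * K ^ 3 < K ^ n.+1)%N -> (u * K ^ 2 < K ^ n)%N.
  by rewrite (expnSr K n) (expnSr K 2) mulnA ltn_pmul2r //; lia.
have ub (u : nat) : (u * K ^ 2 < K ^ n)%N -> u%:R <= N / k ^+ 2.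
  by move=> hu; rewrite ler_pdivlMr ?exprn_gt0 // /N /k -!natrX -natrM ler_nat ltnW.
have ltKn (u : nat) : (u * K ^ 2 < K ^ n)%N -> (u < K ^ n)%N.
  by apply: leq_ltn_trans; rewrite leq_pmulr // expn_gt0; lia.
set A := q%:R * x - th - p%:~R in h.
set A' := q'%:R * x' - th - p'%:~R in h'.
have bA (u : nat) (B : R) : (K ^ n <= u * K ^ 3)%N -> u%:R * B < inhom_c K ->
    B < inhom_c K * k ^+ 3 / N.
  move=> hu hB; have up : 0 < u%:R :> R.
    by apply: lt_le_trans (lb _ hu); rewrite divr_gt0 ?exprn_gt0.
  rewrite -(ltr_pM2l up); apply: (lt_le_trans hB).
  rewrite -[X in X <= _]mulr1 (_ : _ * (_ / N) = inhom_c K * (u%:R * (k ^+ 3 / N))); last by ring.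
  rewrite ler_wpM2l //; first by rewrite invr_ge0 mulr_ge0 ?exprn_ge0 // ltW.
  have := lb _ hu; rewrite ler_pdivrMr ?exprn_gt0 // => h3.
  by rewrite mulrA ler_pdivlMr // mul1r.
have bA1 := bA _ _ q1 h. have bA2 := bA _ _ q1' h'.
have LN : stage_len K n = (2 * N ^+ 2 * k ^+ 2)^-1.
  by rewrite stage_lenE.
have LN1 : stage_len K n.+1 = (2 * N ^+ 2 * k ^+ 4)^-1.
  by rewrite stage_lenE -/k (exprS k n) -/N; congr (_^-1); ring.
have e : (q%:R - q'%:R) * x - (p - p')%:~R = A - A' + q'%:R * (x' - x).
  rewrite /A /A' rmorphB /=; ring.
have bd : `|(q%:R - q'%:R) * x - (p - p')%:~R| <
    2 * (inhom_c K * k ^+ 3 / N) + N / k ^+ 2 * stage_len K n.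
  rewrite e; apply: (le_lt_trans (ler_normD _ _)).
  have : `|q'%:R * (x' - x)| <= N / k ^+ 2 * stage_len K n.
    rewrite normrM normr_nat distrC; apply: ler_pM => //.
    exact/ub/ubn.
  have := ler_normB A A'; lra.
have kk : 2 * (inhom_c K * k ^+ 3 / N) + N / k ^+ 2 * stage_len K n <=
    hom_c K * k ^+ 2 / N.
  rewrite LN /inhom_c /hom_c -/k.
  have -> : 2 * ((4 * k ^+ 10)^-1 * k ^+ 3 / N) + N / k ^+ 2 / (2 * N ^+ 2 * k ^+ 2)
     = (1 / 2 + k ^+ 3 / 2) / (k ^+ 7 * N) by field; rewrite ?Nn0 ?kn0.
  have -> : (4 * k ^+ 5)^-1 * k ^+ 2 / N = (k ^+ 4 / 4) / (k ^+ 7 * N).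
    by field; rewrite ?Nn0 ?kn0.
  rewrite ler_pM2r ?invr_gt0 ?mulr_gt0 ?exprn_gt0 //.
  have : 1 <= k ^+ 3 by rewrite exprn_ege1 //; lra.
  rewrite (exprS k 3) => k3.
  have : 4 * k ^+ 3 <= k * k ^+ 3 by rewrite ler_pM2r //; lra.
  lra.
have [eqq|neq] := eqVneq q q'.
  subst q'.
  have kk1 : hom_c K * k ^+ 2 / N < 1.
    rewrite ltr_pdivrMr // mul1r; apply: lt_le_trans N1.
    rewrite (_ : _ * _ = (4 * k ^+ 3)^-1); last by rewrite /hom_c -/k; field.
    have k31 : 1 <= k ^+ 3 by rewrite exprn_ege1 //; lra.
    by rewrite invf_lt1; lra.
  have pp : p - p' = 0.
    apply: int_norm_lt1_eq0; rewrite -normrN.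
    by move: bd; rewrite subrr mul0r sub0r; lra.
  have e2 : q%:R * (x - x') = A - A'.
    move/eqP: (pp); rewrite subr_eq0 => /eqP pE.
    by rewrite /A /A' pE; ring.
  have : q%:R * (q%:R * `|x - x'|) < 2 * inhom_c K.
    rewrite -{2}(@normr_nat R q) -normrM e2.
    apply: (@le_lt_trans _ _ (q%:R * `|A| + q%:R * `|A'|)); last by lra.
    by rewrite -mulrDr ler_wpM2l // ler_normB.
  have lq := lb _ q1.
  rewrite mulrA -expr2 => hh.
  have : (N / k ^+ 3) ^+ 2 * `|x - x'| < 2 * inhom_c K.
    apply: le_lt_trans hh; rewrite ler_wpM2r // lerXn2r ?nnegrE //.
    by rewrite divr_ge0 ?exprn_ge0 // ltW.
  have pos : 0 < (N / k ^+ 3) ^+ 2 by rewrite exprn_gt0 // divr_gt0 ?exprn_gt0.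
  rewrite mulrC -ltr_pdivlMr // LN1 => /lt_le_trans; apply.
  rewrite le_eqVlt; apply/orP; left; apply/eqP.
  by rewrite /inhom_c -/k; field; rewrite ?Nn0 ?kn0.
have lq : (q' < q)%N by rewrite ltn_neqAle eq_sym neq.
have q2n := ubn _ q2.
have q2d : ((q - q') * K ^ 2 < K ^ n)%N.
  by apply: leq_ltn_trans q2n; rewrite leq_mul2r leq_subr orbT.
have /hom : (0 < q - q' < K ^ n)%N by rewrite subn_gt0 lq ltKn.
move=> /(_ (p - p')); rewrite natrB // => hc.
have ubd := ub _ q2d; rewrite natrB // in ubd.
have : hom_c K < (N / k ^+ 2) * (hom_c K * k ^+ 2 / N).
  apply: (le_lt_trans hc).
  apply: (@le_lt_trans _ _ (N / k ^+ 2 * `|(q%:R - q'%:R) * x - (p - p')%:~R|)).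
    by rewrite ler_wpM2r.
  by rewrite ltr_pM2l ?divr_gt0 ?exprn_gt0 //; lra.
rewrite (_ : _ * (_ / N) = hom_c K) ?ltxx //.
by field; rewrite ?Nn0 ?kn0.
Qed.
End Approx.

(** * The two lower limits *)

Section Liminf.
Variable R : realType.
Local Open Scope ereal_scope.

Lemma le_limn_einf (u : (\bar R)^nat) (l : \bar R) :
  (\forall n \near \oo, l <= u n) -> l <= limn_einf u.
Proof.
case=> N _ h; rewrite limn_einf_lim.
apply: (@le_trans _ _ (einfs u N)).
  by apply: le_ereal_inf_tmp => _ [n /= Nn <-]; exact: h.
apply: lime_ge; first exact: is_cvg_einfs.
by exists N => // n /= Nn; exact: nondecreasing_einfs.
Qed.

Lemma limn_einf_le (u v : (\bar R)^nat) :
  (forall n, u n <= v n) -> limn_einf u <= limn_einf v.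
Proof.
move=> uv; rewrite [leLHS]limn_einf_lim.
apply: lime_le; first exact: is_cvg_einfs.
exists 0%N => // n _; apply: le_limn_einf; exists n => // m /= nm.
by apply: le_trans (uv m); apply: ereal_inf_lbound; exists m.
Qed.

(** Let l be the infimum of n * f n over n > N. For large Q, Q * f q >= l holds for
    all q <= Q: if q > N because q * f q >= l, and if q <= N because
    f q >= c / q >= c / N, whence Q * f q is large. *)
Lemma limn_einf_min_upto (f : nat -> R) (c : R) :
  (0 < c)%R -> (forall q, (0 < q)%N -> (c <= q%:R * f q)%R) ->
  liminf_pos (fun Q => Q%:R%:E * min_upto f Q) =
    liminf_pos (fun q => (q%:R * f q)%:E) /\
  0 < liminf_pos (fun q => (q%:R * f q)%:E).
Proof.
move=> c0 fc; split; last first.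
  apply: (@lt_le_trans _ _ c%:E); first by rewrite lte_fin.
  by apply: le_limn_einf; exists 0%N => // n _; rewrite lee_fin fc.
have fpos q : (0 < q)%N -> (0 < f q)%R.
  move=> q0; have := lt_le_trans c0 (fc q q0).
  by rewrite pmulr_rgt0 ?ltr0n.
apply/eqP; rewrite eq_le; apply/andP; split.
  apply: limn_einf_le => n; rewrite EFinM lee_pmul2l ?lte_fin ?ltr0n //.
  by rewrite /min_upto big_nat_recr //= ge_min lexx orbT.
rewrite [leLHS]/liminf_pos limn_einf_lim.
apply: lime_le; first exact: is_cvg_einfs.
exists 0%N => // N _.
set v := fun n => (n.+1%:R * f n.+1)%:E.
set l := einfs v N.
have lv n : (N <= n)%N -> l <= v n by move=> Nn; apply: ereal_inf_lbound; exists n.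
have c_le n : (c%:E <= v n) by rewrite lee_fin fc.
have l_ge : c%:E <= l by apply: le_ereal_inf_tmp => _ [n _ <-]; exact: c_le.
have l_fin : l \is a fin_num.
  rewrite fin_numElt (lt_le_trans (ltNyr c) l_ge) /=.
  exact: (le_lt_trans (lv N (leqnn N)) (ltry _)).
set r := fine l; have lE : l = r%:E by rewrite fineK.
have rv n : (N <= n)%N -> (r <= n.+1%:R * f n.+1)%R.
  by move=> /lv; rewrite lE lee_fin.
apply: le_limn_einf.
exists (Num.bound `|r * N%:R / c|%R) => // n /= nB.
have {}Nn : (r * N%:R <= n.+1%:R * c)%R.
  rewrite -ler_pdivrMr //; apply/ltW/(le_lt_trans (ler_norm _)).
  apply: (lt_le_trans (archi_boundP (normr_ge0 _))); rewrite ler_nat.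
  exact: leqW.
rewrite lE -lee_pdivrMl ?ltr0n // -EFinM /min_upto big_nat.
apply: le_bigmin => [|q /andP[q0 qn]]; first exact: leey.
rewrite lee_fin ler_pdivrMl ?ltr0n //.
have [Nq|qN] := ltnP N q.
  case: q q0 qn Nq => // q _ qn Nq; apply: le_trans (rv _ Nq) _.
  by rewrite ler_pM2r ?fpos // ler_nat.
have qp : (0 < q%:R :> R)%R by rewrite ltr0n.
rewrite -(ler_pM2l qp) mulrCA.
apply: (@le_trans _ _ (n.+1%:R * c)%R); last by rewrite ler_pM2l ?ltr0n ?fc.
apply: le_trans Nn; rewrite mulrC ler_wpM2l ?ler_nat //.
rewrite -lee_fin -lE; apply: le_trans l_ge; rewrite lee_fin; exact: ltW.
Qed.
End Liminf.

(** * Weights of families of sets *)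

Section Weights.
Variables (R : realType) (w : nat -> R).
Hypothesis w_ge0 : forall i, 0 <= w i.
Local Open Scope ereal_scope.

Definition weight (A : set nat) : \bar R :=
  \sum_(0 <= i <oo) (if `[< A i >] then (w i)%:E else 0).

Lemma weight_term_ge0 (A : set nat) i : 0 <= if `[< A i >] then (w i)%:E else 0.
Proof. by case: ifP; rewrite ?lee_fin. Qed.

Lemma weight_le (A B : set nat) : A `<=` B -> weight A <= weight B.
Proof.
move=> AB; apply: lee_nneseries => [i _ _|i _]; first exact: weight_term_ge0.
case: asboolP => [/AB Bi|_]; last exact: weight_term_ge0.
by case: asboolP.
Qed.

Lemma weight_ge (A : set nat) i : A i -> (w i)%:E <= weight A.
Proof.
move=> Ai; apply: (@le_trans _ _ (\sum_(0 <= j < i.+1)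
    (if `[< A j >] then (w j)%:E else 0))).
  rewrite big_nat_recr //= (asboolT Ai) leeDr // sume_ge0 // => j _.
  exact: weight_term_ge0.
by apply: nneseries_lim_ge => j _ _; exact: weight_term_ge0.
Qed.

Lemma weight_disjoint_sum (I : finType) (G : {set I}) (A : I -> set nat)
    (B : set nat) :
  (forall j, A j `<=` B) ->
  (forall i j j', B i -> A j i -> A j' i -> j = j') ->
  \sum_(j in G) weight (A j) <= weight B.
Proof.
move=> AB uA; rewrite -nneseries_sum => [|j i _]; last exact: weight_term_ge0.
apply: lee_nneseries => [i _ _|i _].
  by apply: sume_ge0 => j _; exact: weight_term_ge0.
have [[j [Gj Aj]]|nA] := pselect (exists j, j \in G /\ A j i).
  rewrite (bigD1 j) //= big1 ?adde0 => [|j' /andP[_ jj']].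
    by rewrite (asboolT Aj) (asboolT (AB _ _ Aj)).
  case: asboolP => // Aj'; case/eqP: jj'.
  exact: uA (AB _ _ Aj) Aj' Aj.
rewrite big1 => [|j Gj]; first exact: weight_term_ge0.
by case: asboolP => // Aj; case: nA; exists j.
Qed.

(** Averaging: at least m - 2 of the indices belong to neither bad set, and as the
    A j are disjoint subsets of B, their weights add up to at most the weight of
    B. *)
Lemma exists_light_child (m : nat) (bad1 bad2 : set 'I_m) (A : 'I_m -> set nat)
    (B : set nat) (b : R) :
  (2 < m)%N ->
  (forall j j', bad1 j -> bad1 j' -> j = j') ->
  (forall j j', bad2 j -> bad2 j' -> j = j') ->
  (forall j, A j `<=` B) ->
  (forall i j j', B i -> A j i -> A j' i -> j = j') ->
  (0 <= b)%R -> weight B < b%:E ->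
  exists j, [/\ ~ bad1 j, ~ bad2 j & weight (A j) < (b / (m - 2)%:R)%:E].
Proof.
move=> m2 u1 u2 AB uA b0 WB; apply: contrapT => noj.
pose B1 := [set j | `[< bad1 j >]]%SET; pose B2 := [set j | `[< bad2 j >]]%SET.
have c1 : (#|B1| <= 1)%N.
  by apply/card_le1_eqP => j j'; rewrite !inE => h h'; apply: u1.
have c2 : (#|B2| <= 1)%N.
  by apply/card_le1_eqP => j j'; rewrite !inE => h h'; apply: u2.
pose G := (~: (B1 :|: B2))%SET.
have cG : (m - 2 <= #|G|)%N.
  have U2 : (#|(B1 :|: B2)%SET| <= 2)%N.
    rewrite cardsU; apply: leq_trans (leq_subr _ _) _; exact: (leq_add c1 c2).
  by rewrite /G cardsCs finset.setCK card_ord leq_sub2l.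
have := weight_disjoint_sum G AB uA.
apply/negP; rewrite -ltNge; apply: (lt_le_trans WB).
have m0 : (0 < (m - 2)%:R :> R)%R by rewrite ltr0n; lia.
apply: (@le_trans _ _ (\sum_(j in G) (b / (m - 2)%:R)%:E)).
  rewrite sumEFin lee_fin sumr_const -[(_ *+ #|_|)%R]mulr_natr -mulrA.
  apply: ler_peMr => //.
  by rewrite mulrC ler_pdivlMr // mul1r ler_nat.
apply: lee_sum => j; rewrite !inE negb_or => /andP[/asboolPn n1 /asboolPn n2].
by rewrite leNgt; apply/negP => lt; apply: noj; exists j.
Qed.
End Weights.

(** * The nested intervals *)

Section Core.
Variables (R : realType) (th : R) (r : nat) (F : nat -> set R) (w : nat -> R).
Let K := (2 * r)%N.
Let m := (2 * r ^ 2)%N.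
Let lam : R := ((m - 2)%:R)^-1.
Hypothesis r2 : (2 <= r)%N.
Hypothesis w_gt0 : forall i, 0 < w i.
Hypothesis w_diam : forall i n x y,
  w i < lam ^+ n -> F i x -> F i y -> `|x - y| < stage_len R K n.+1.

Let w_ge0 i : 0 <= w i. Proof. exact: ltW. Qed.
Let m8 : (8 <= m)%N. Proof. rewrite /m; nia. Qed.
Let K4 : (4 <= K)%N. Proof. by rewrite /K; lia. Qed.
Let K0 : (0 < K)%N. Proof. by rewrite /K; lia. Qed.
Let lam_gt0 : 0 < lam. Proof. by rewrite invr_gt0 ltr0n; lia. Qed.

(** An interval of stage n is represented by its left end point a. *)
Definition in_stage n a x := a <= x <= a + stage_len R K n.

Definition meeting n a : set nat := [set i | exists x, F i x /\ in_stage n a x].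

Definition admissible n a :=
  (forall x, in_stage n a x ->
    (forall q (p : int), (0 < q < K ^ n)%N ->
      hom_c R K <= q%:R * `|q%:R * x - p%:~R|) /\
    (forall q (p : int), (0 < q)%N -> (q * K ^ 3 < K ^ n)%N ->
      inhom_c R K <= q%:R * `|q%:R * x - th - p%:~R|)) /\
  (weight w (meeting n a) < (lam ^+ n)%:E)%E.

(** The factor 2 leaves a gap as long as a child between any two children. *)
Definition child n a (j : 'I_m) := a + 2 * j%:R * stage_len R K n.+1.

Lemma child_sub n a (j : 'I_m) :
  a <= child n a j /\ child n a j + stage_len R K n.+1 <= a + stage_len R K n.
Proof.
have l0 := stage_len_gt0 R n.+1 K0; rewrite /child; split.
  by rewrite lerDl !mulr_ge0 // ltW.
rewrite -addrA lerD2l (stage_lenS _ n K0) -[X in _ + X]mul1r -mulrDl ler_pM2r //.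
rewrite -natrM -natrX natr1 ler_nat /K.
have := ltn_ord j; rewrite /m; nia.
Qed.

Lemma child_in n a (j : 'I_m) x :
  in_stage n.+1 (child n a j) x -> in_stage n a x.
Proof.
have [h1 h2] := child_sub n a j; rewrite /in_stage => /andP[h3 h4].
by rewrite (le_trans h1 h3) (le_trans h4 h2).
Qed.

Lemma stage_dist n a x y : in_stage n a x -> in_stage n a y ->
  `|x - y| <= stage_len R K n.
Proof. by move=> /andP[h1 h2] /andP[h3 h4]; rewrite ler_norml; lra. Qed.

Lemma child_inj n a (j j' : 'I_m) x x' :
  in_stage n.+1 (child n a j) x -> in_stage n.+1 (child n a j') x' ->
  `|x - x'| < stage_len R K n.+1 -> j = j'.
Proof.
wlog jj : j j' x x' / (j <= j')%N.
  move=> H h h' d; have [le|/ltnW le] := leqP j j'; first exact: H le h h' d.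
  by apply/esym; apply: H le h' h _; rewrite distrC.
move=> /andP[h1 h2] /andP[h3 h4] d; apply/val_inj/eqP; rewrite eqn_leq jj /=.
rewrite leqNgt; apply/negP => lt.
have l0 := stage_len_gt0 R n.+1 K0.
have : (j%:R + 1) * stage_len R K n.+1 <= j'%:R * stage_len R K n.+1.
  by rewrite ler_pM2r // natr1 ler_nat.
move: h1 h2 h3 h4 d; rewrite /child ltr_norml => h1 h2 h3 h4 /andP[d1 d2] h5.
lra.
Qed.

(** At most one child is lost to approximation by fractions and at most one to
    inhomogeneous approximation. The sets F i that meet the interval have weight
    below lam ^ n, so they are too short to meet two children. *)
Lemma exists_admissible_child n a : admissible n a ->
  exists a', [/\ a <= a', a' + stage_len R K n.+1 <= a + stage_len R K n &
    admissible n.+1 a'].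
Proof.
case=> good light.
pose bad1 : set 'I_m := [set j | exists x q (p : int),
  [/\ in_stage n.+1 (child n a j) x, (K ^ n <= q < K ^ n.+1)%N &
    q%:R * `|q%:R * x - p%:~R| < hom_c R K]].
pose bad2 : set 'I_m := [set j | exists x q (p : int),
  [/\ in_stage n.+1 (child n a j) x, (K ^ n <= q * K ^ 3 < K ^ n.+1)%N &
    q%:R * `|q%:R * x - th - p%:~R| < inhom_c R K]].
have u1 j j' : bad1 j -> bad1 j' -> j = j'.
  move=> [x [q [p [hx hq h]]]] [x' [q' [p' [hx' hq' h']]]].
  apply: (child_inj hx hx'); apply: (hom_approx_close _ hq hq' _ h h'); first by rewrite /K; lia.
  exact: stage_dist (child_in hx) (child_in hx').
have u2 j j' : bad2 j -> bad2 j' -> j = j'.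
  move=> [x [q [p [hx hq h]]]] [x' [q' [p' [hx' hq' h']]]].
  wlog le : j j' x x' q q' p p' hx hq h hx' hq' h' / (q' <= q)%N.
    move=> H; have [le|/ltnW le] := leqP q' q; last apply/esym.
      exact: (H _ _ _ _ _ _ _ _ hx hq h hx' hq' h').
    exact: (H _ _ _ _ _ _ _ _ hx' hq' h' hx hq h).
  apply: (child_inj hx hx'); apply: (inhom_approx_close K4 hq hq' _ _ le h h') => //.
    exact: stage_dist (child_in hx) (child_in hx').
  by case: (good _ (child_in hx)).
have AB (j : 'I_m) : meeting n.+1 (child n a j) `<=` meeting n a.
  by move=> i [x [Fx hx]]; exists x; split => //; exact: child_in hx.
have uA i (j j' : 'I_m) : meeting n a i -> meeting n.+1 (child n a j) i ->
    meeting n.+1 (child n a j') i -> j = j'.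
  move=> mi [x [Fx hx]] [x' [Fx' hx']]; apply: (child_inj hx hx').
  apply: w_diam Fx Fx'; rewrite -lte_fin.
  exact: le_lt_trans (weight_ge w_ge0 mi) light.
have m2 : (2 < m)%N by lia.
have [|j [n1 n2 lj]] := exists_light_child w_ge0 m2 u1 u2 AB uA _ light.
  by rewrite exprn_ge0 // ltW.
exists (child n a j); have [h1 h2] := child_sub n a j; split=> //; split; last first.
  by rewrite exprSr.
move=> x hx; have [g1 g2] := good _ (child_in hx); split=> q p.
  move=> /andP[q0 qK]; have [qn|qn] := ltnP q (K ^ n); first by rewrite g1 ?q0.
  rewrite leNgt; apply/negP => lt; apply: n1; exists x, q, p.
  by rewrite qn qK.
move=> q0 qK; have [qn|qn] := ltnP (q * K ^ 3) (K ^ n); first exact: g2.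
rewrite leNgt; apply/negP => lt; apply: n2; exists x, q, p.
by rewrite qn qK.
Qed.

(** The intersection point x of a nested sequence of admissible intervals: if F i
    contained x, it would meet all of them, and its positive weight would be
    smaller than every lam ^ n. *)
Lemma exists_inhom_bad_avoiding a0 : (weight w setT < 1)%E ->
  exists x, [/\ a0 <= x <= a0 + stage_len R K 0,
    forall q (p : int), (0 < q)%N ->
      inhom_c R K <= q%:R * `|q%:R * x - th - p%:~R| &
    forall i, ~ F i x].
Proof.
move=> w1.
have adm0 : admissible 0 a0.
  split => [x _|]; last first.
    by apply: le_lt_trans w1; apply: weight_le.
  split=> q p; first by rewrite expn0; lia.
  by rewrite expn0 => q0; have := expn_gt0 K 3; nia.
pose T := {na : nat * R | admissible na.1 na.2}.
pose rel (s t : T) := [/\ (sval t).1 = (sval s).1.+1, (sval s).2 <= (sval t).2 &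
  (sval t).2 + stage_len R K (sval t).1 <= (sval s).2 + stage_len R K (sval s).1].
have step (s : T) : {t : T | rel s t}.
  apply: cid; case: s => [[n a] /= adm].
  have [a' [h1 h2 adm']] := exists_admissible_child adm.
  by exists (exist _ (n.+1, a') adm').
have [f [f0 fS]] := dependent_choice step (exist _ (0%N, a0) adm0).
pose s n := (sval (f n)).2.
have idx n : (sval (f n)).1 = n.
  by elim: n => [|n IHn]; [rewrite f0|case: (fS n) => ->; rewrite IHn].
have adm n : admissible n (s n) by have := svalP (f n); rewrite idx.
have up n : s n <= s n.+1 by case: (fS n).
have dn n : s n.+1 + stage_len R K n.+1 <= s n + stage_len R K n.
  by case: (fS n) => _ _; rewrite !idx.
have mono : {homo s : n k / (n <= k)%N >-> n <= k}.
  exact: (homo_leq (@lexx _ _) (@le_trans _ _) up).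
have anti n k : (n <= k)%N -> s k + stage_len R K k <= s n + stage_len R K n.
  elim: k => [|k IHk]; first by rewrite leqn0 => /eqP ->.
  rewrite leq_eqVlt => /predU1P[->//|]; rewrite ltnS => /IHk.
  exact: le_trans (dn k).
have le_end n k : s n <= s k + stage_len R K k.
  have [nk|/ltnW kn] := leqP n k.
    by apply: (le_trans (mono _ _ nk)); rewrite lerDl ltW ?stage_len_gt0.
  by apply: le_trans (anti _ _ kn); rewrite lerDl ltW ?stage_len_gt0.
pose x := sup (range s).
have x_in n : in_stage n (s n) x.
  apply/andP; split.
    apply: ub_le_sup; last by exists n.
    by exists (s 0%N + stage_len R K 0) => _ [k _ <-].
  apply: ge_sup; first by exists (s 0%N), 0%N.
  by move=> _ [k _ <-].
have s0 : s 0%N = a0 by rewrite /s f0.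
exists x; split; first by have := x_in 0%N; rewrite /in_stage s0.
  (* The stage q * K ^ 3 is late enough, as n < K ^ n. *)
  move=> q p q0; have [/(_ _ (x_in (q * K ^ 3)%N)) [_ h] _] := adm (q * K ^ 3)%N.
  by apply: h => //; rewrite ltn_expl //; lia.
move=> i Fi.
have small n : w i < lam ^+ n.
  have [_ lt] := adm n; rewrite -lte_fin; apply: le_lt_trans lt.
  by apply: weight_ge => //; exists x.
have lamh : lam <= 1 / 2.
  rewrite div1r lef_pV2 ?posrE ?ltr0n ?ler_nat //; lia.
have /cvgrPdist_lt/(_ _ (w_gt0 i)) [N _ /(_ N (leqnn N))] : lam ^+ n @[n --> \oo] --> (0 : R).
  by apply: cvg_expr; rewrite gtr0_norm //; lra.
rewrite sub0r normrN ger0_norm ?exprn_ge0 // ?(ltW lam_gt0) // => /(lt_trans (small N)).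
by rewrite ltxx.
Qed.
End Core.

(** * Numbers that stay away from the shifted integers *)

Section DistInt.
Variable R : realType.
Implicit Types (x y z th c : R) (q b : nat).

Lemma dist_int_ge y c : (forall p : int, c <= `|y - p%:~R|) -> c <= dist_int y.
Proof.
by move=> h; apply: lb_le_inf => [|_ [p _ <-]]; [exists `|y - 0%:~R|, 0|].
Qed.

Lemma not_int_dist z : z \isn't a Num.int ->
  exists2 c, 0 < c & forall p : int, c <= `|z - p%:~R|.
Proof.
move=> zN; set f := Num.floor z.
have /andP[f1 f2] := floor_itv z; rewrite -/f intrD in f1 f2.
have {}f1 : f%:~R < z.
  rewrite lt_neqAle f1 andbT; apply: contraNneq zN => <-; exact: intr_int.
exists (Num.min (z - f%:~R) (f%:~R + 1 - z)).
  by rewrite lt_min !subr_gt0 f1.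
move=> p; have [pf|fp] := leP p f.
  have : (p%:~R : R) <= f%:~R by rewrite ler_int.
  by move=> h; rewrite ge_min; apply/orP; left; apply: le_trans (ler_norm _); lra.
have : (f%:~R : R) + 1 <= p%:~R by rewrite -(intrD _ f 1) ler_int -ltzD1 ltrD2r.
move=> h; rewrite ge_min distrC; apply/orP; right.
by apply: le_trans (ler_norm _); lra.
Qed.

Definition uniformly_far th y :=
  exists2 c, 0 < c & forall q, c <= dist_int (q%:R * y - th).

Definition inhom_bad th x :=
  exists2 c, 0 < c & forall q, (0 < q)%N -> c <= q%:R * dist_int (q%:R * x - th).

(** For p an integer, b * (q * (a / b) - th - p) is an integer minus b * th. *)
Lemma rational_uniformly_far th (a : int) b : (0 < b)%N ->
  b%:R * th \isn't a Num.int -> uniformly_far th (a%:~R / b%:R).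
Proof.
move=> b0 /not_int_dist[c c0 hc].
have bp : 0 < b%:R :> R by rewrite ltr0n.
exists (c / b%:R) => [|q]; first exact: divr_gt0.
apply: dist_int_ge => p; rewrite ler_pdivrMr //.
rewrite -[X in _ * X]gtr0_norm // -normrM.
have := hc (q%:Z * a - p * b%:Z); rewrite distrC intrB !intrM.
congr (_ <= `|_|); rewrite -!pmulrn; field.
by rewrite gt_eqF.
Qed.

(** If both b * th and b.+1 * th were integers, so would be their difference
    th; hence denominators that suit [rational_uniformly_far] can be taken
    arbitrarily large. *)
Lemma uniformly_far_dense th x y : th \isn't a Num.int -> x < y ->
  exists2 t, x < t < y & uniformly_far th t.
Proof.
move=> thN xy.
have [b b0 [hb bN]] : exists2 b, (0 < b)%N &
    1 < b%:R * (y - x) /\ b%:R * th \isn't a Num.int.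
  set b := (Num.bound `|(y - x)^-1|).+1.
  have hb : 1 < b%:R * (y - x).
    rewrite -ltr_pdivrMr ?subr_gt0 // mul1r; apply: (le_lt_trans (ler_norm _)).
    by apply: (lt_le_trans (archi_boundP (normr_ge0 _))); rewrite ler_nat.
  have [bi|bN] := boolP (b%:R * th \is a Num.int); last by exists b.
  exists b.+1 => //; split.
    by apply: (lt_trans hb); rewrite ltr_pM2r ?subr_gt0 // ltr_nat.
  apply: contra thN => b1i.
  have -> : th = b.+1%:R * th - b%:R * th by rewrite -natr1; ring.
  by rewrite rpredB.
have bp : 0 < b%:R :> R by rewrite ltr0n.
have /andP[] := floor_itv (b%:R * x); set f := Num.floor _ => f1 f2.
exists ((f + 1)%:~R / b%:R); last exact: rational_uniformly_far.
rewrite intrD in f2 *.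
by rewrite ltr_pdivlMr // ltr_pdivrMr //; lra.
Qed.

Lemma inhom_bad_of_le (c th x : R) : 0 < c ->
  (forall q (p : int), (0 < q)%N -> c <= q%:R * `|q%:R * x - th - p%:~R|) ->
  inhom_bad th x.
Proof.
move=> c0 h; exists c => // q q0; rewrite mulrC -ler_pdivrMr ?ltr0n //.
by apply: dist_int_ge => p; rewrite ler_pdivrMr ?ltr0n // mulrC h.
Qed.

Lemma inhom_c_gt0 K : (0 < K)%N -> 0 < inhom_c R K.
Proof. by move=> K0; rewrite invr_gt0 mulr_gt0 ?exprn_gt0 ?ltr0n. Qed.

(** The construction with a family of empty sets, whose weights are arbitrary
    positive numbers of sum at most 1/2. *)
Lemma inhom_bad_dense th x y : x < y -> exists2 t, x < t < y & inhom_bad th t.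
Proof.
move=> xy; pose z := (x + y) / 2.
pose r := (Num.bound `|(y - z)^-1|).+2.
pose w i : R := (1 / 2) / (2 ^ i.+1)%:R.
have w0 i : 0 < w i by rewrite divr_gt0 ?ltr0n ?expn_gt0 //; lra.
have wS : (weight w setT < 1)%E.
  apply: (@le_lt_trans _ _ (1 / 2)%:E); last by rewrite lte_fin; lra.
  have -> : weight w setT = (\sum_(0 <= i <oo) (1 / 2 / (2 ^ i.+1)%:R)%:E)%E.
    by apply: eq_eseriesr => i _; rewrite asboolT.
  by apply: epsilon_trick0; lra.
have [//|//|t [/andP[t1 t2] tb _]] :=
  @exists_inhom_bad_avoiding R th r (fun=> set0) w _ w0 _ z wS.
exists t; last exact: inhom_bad_of_le (inhom_c_gt0 _) tb.
have zy : 0 < y - z by rewrite /z; lra.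
have rb : (y - z)^-1 < r%:R.
  apply: (le_lt_trans (ler_norm _)).
  by apply: (lt_le_trans (archi_boundP (normr_ge0 _))); rewrite ler_nat;
    exact: leqW (leqnSn _).
apply/andP; split; first by apply: lt_le_trans t1; rewrite /z; lra.
apply: (le_lt_trans t2); rewrite -ltrBrDl.
apply: (@le_lt_trans _ _ r%:R^-1); last by rewrite invf_plt ?posrE.
rewrite /stage_len double0 lef_pV2 ?posrE ?mulr_gt0 ?exprn_gt0 ?ltr0n //.
by rewrite -natrX -natrM ler_nat; rewrite /r; nia.
Qed.

(** The number of safe children is at least the s-th power of the ratio (2r)^2 of
    successive lengths: this is where s < 1 enters. *)
Lemma exists_branching (s : R) : s < 1 ->
  exists2 r : nat, (2 <= r)%N & ((2 * r)%:R ^+ 2) `^ s <= (2 * r ^ 2 - 2)%:R :> R.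
Proof.
move=> s1; set r := (Num.bound `|4 `^ (1 - s)^-1 : R|).+2; exists r => //.
set t : R := _ ^+ 2.
have r2 : 2 <= r%:R :> R by rewrite ler_nat.
have tE : t = 4 * r%:R ^+ 2 by rewrite /t natrM; ring.
have t16 : 16 <= t by rewrite tE; nra.
have -> : (2 * r ^ 2 - 2)%:R = t / 2 - 2 :> R.
  by rewrite natrB ?natrM ?natrX ?tE; [lra|rewrite /r; nia].
have t4 : 4 <= t `^ (1 - s).
  have s0 : 1 - s != 0 by rewrite gt_eqF // subr_gt0.
  have -> : 4 = (4 `^ (1 - s)^-1) `^ (1 - s) :> R by rewrite -powRrM mulVf ?powRr1.
  apply: ge0_ler_powR; rewrite ?nnegrE ?powR_ge0 ?subr_ge0 ?(ltW s1) //; first lra.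
  apply: (@le_trans _ _ r%:R); last by rewrite tE; nra.
  apply: le_trans (ler_norm _) _; apply: ltW.
  by apply: (lt_le_trans (archi_boundP (normr_ge0 _))); rewrite ler_nat;
    exact: leqW (leqnSn _).
have t0 : 0 < t by lra.
have tn0 : t != 0 by rewrite gt_eqF.
have e : t = t `^ s * t `^ (1 - s).
  rewrite -powRD; last by rewrite tn0 implybT.
  by rewrite addrC subrK powRr1 // ltW.
have p0 := powR_ge0 t s.
have : t `^ s * 4 <= t by rewrite [leRHS]e ler_wpM2l.
by clear -t16; lra.
Qed.

(** A set of diameter d gets the weight C d^s, scaled so that weight below lam ^ n
    means diameter below the length of stage n.+1, plus a summable positive
    term: sets of diameter 0 must have positive weight too. *)
Lemma inhom_bad_avoids_light_cover (th s : R) : 0 < s -> s < 1 ->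
  exists2 eps : R, 0 < eps & forall (F : nat -> set R) (d : nat -> R),
    (forall i, 0 <= d i) ->
    (forall i x y, F i x -> F i y -> `|x - y| <= d i) ->
    (\sum_(0 <= i <oo) (d i `^ s)%:E < eps%:E)%E ->
    exists2 x, inhom_bad th x & forall i, ~ F i x.
Proof.
move=> s0 s1; have [r r2 hr] := exists_branching s1.
set K := (2 * r)%N in hr.
have K0 : (0 < K)%N by rewrite /K; lia.
pose k : R := K%:R.
have k0 : 0 < k by rewrite ltr0n.
pose C := (2 * k ^+ 4) `^ s.
have c0 : 0 < 2 * k ^+ 4 by rewrite mulr_gt0 ?exprn_gt0.
have C0 : 0 < C by rewrite powR_gt0.
exists (C^-1 / 2) => [|F d d0 Fd dS]; first by rewrite divr_gt0 ?invr_gt0.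
pose w i : R := C * d i `^ s + (1 / 2) / (2 ^ i.+1)%:R.
have w0 i : 0 < w i.
  apply: ltr_wpDl; first by rewrite mulr_ge0 ?powR_ge0 ?(ltW C0).
  by rewrite divr_gt0 ?ltr0n ?expn_gt0 //; lra.
have wS : (weight w setT < 1)%E.
  have -> : weight w setT =
      (\sum_(0 <= i <oo) (C%:E * (d i `^ s)%:E + (1 / 2 / (2 ^ i.+1)%:R)%:E))%E.
    by apply: eq_eseriesr => i _; rewrite asboolT.
  apply: (@le_lt_trans _ _
    (\sum_(0 <= i <oo) (C%:E * (d i `^ s)%:E) + (1 / 2)%:E)%E).
    apply: epsilon_trick => [i|]; last by lra.
    by rewrite -EFinM lee_fin mulr_ge0 ?powR_ge0 ?(ltW C0).
  rewrite nneseriesZl => [|i _]; last by rewrite lee_fin powR_ge0.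
  rewrite -lteBrDr // -EFinB -lte_pdivlMl // -EFinM.
  by apply: (lt_le_trans dS); rewrite lee_fin; lra.
have wd i n x y : w i < ((2 * r ^ 2 - 2)%:R)^-1 ^+ n -> F i x -> F i y ->
    `|x - y| < stage_len R K n.+1.
  move=> wi Fx Fy; apply: (le_lt_trans (Fd _ _ _ Fx Fy)).
  have lam0 : 0 < (2 * r ^ 2 - 2)%:R :> R.
    by apply: lt_le_trans hr; rewrite powR_gt0 ?exprn_gt0.
  rewrite stage_lenE -/k (exprS k n); set N := k ^+ n.
  have N0 : 0 < N by rewrite exprn_gt0.
  have -> : (2 * (k * N) ^+ 2 * k ^+ 2)^-1 = (2 * k ^+ 4 * N ^+ 2)^-1.
    by congr (_^-1); ring.
  have P0 : 0 < 2 * k ^+ 4 * N ^+ 2 by rewrite mulr_gt0 ?exprn_gt0.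
  rewrite -[ltRHS]mul1r ltr_pdivlMr // ltNge; apply/negP => le1.
  have le2 : 1 <= C * d i `^ s * ((k ^+ 2) `^ s) ^+ n.
    have -> : ((k ^+ 2) `^ s) ^+ n = (N ^+ 2) `^ s.
      rewrite -powR_mulrn ?powR_ge0 // -powRrM mulrC powRrM powR_mulrn ?exprn_ge0 ?(ltW k0) //.
      by rewrite /N -!exprM mulnC.
    rewrite /C -!powRM ?mulr_ge0 ?exprn_ge0 ?(ltW c0) ?(ltW N0) //.
    rewrite [leLHS](_ : 1 = 1 `^ s); last by rewrite powR1.
    apply: ge0_ler_powR; rewrite ?nnegrE ?(ltW s0) //.
      by rewrite !mulr_ge0 ?exprn_ge0 ?(ltW k0) ?(ltW N0).
    by apply: le_trans le1 _; rewrite le_eqVlt; apply/orP; left; apply/eqP; ring.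
  have le3 : ((k ^+ 2) `^ s) ^+ n <= (2 * r ^ 2 - 2)%:R ^+ n.
    by rewrite lerXn2r ?nnegrE ?powR_ge0 ?(ltW lam0).
  have wC : C * d i `^ s < ((2 * r ^ 2 - 2)%:R)^-1 ^+ n.
    apply: lt_trans wi; rewrite ltrDl divr_gt0 ?ltr0n ?expn_gt0 //; lra.
  move: le2; apply/negP; rewrite -ltNge.
  apply: (@lt_le_trans _ _ (((2 * r ^ 2 - 2)%:R)^-1 ^+ n * ((k ^+ 2) `^ s) ^+ n)).
    by rewrite ltr_pM2r // exprn_gt0 // powR_gt0 ?exprn_gt0.
  rewrite exprVn mulrC ler_pdivrMr ?mul1r ?exprn_gt0 //.
have [x [_ xb xF]] := exists_inhom_bad_avoiding th r2 w0 wd 0 wS.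
by exists x => //; exact: inhom_bad_of_le (inhom_c_gt0 K0) xb.
Qed.
End DistInt.

(** * Dimension and density *)

Section Dimension.
Variable R : realType.

Lemma le_dist2 (p q : R * R) :
  `|p.1 - q.1| <= dist2 p q /\ `|p.2 - q.2| <= dist2 p q.
Proof.
by split; rewrite -sqrtr_sqr ler_wsqrtr // ?lerDl ?lerDr sqr_ge0.
Qed.

Lemma fine_diam (T : Type) (dist : T -> T -> R) (A : set T) :
  (diam dist A <= 1)%E ->
  [/\ diam dist A = (fine (diam dist A))%:E, 0 <= fine (diam dist A) <= 1 &
    forall x y, A x -> A y -> dist x y <= fine (diam dist A)].
Proof.
move=> d1; have d0 : (0 <= diam dist A)%E by rewrite /diam le_max lexx.
have dE : diam dist A = (fine (diam dist A))%:E.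
  by rewrite fineK // fin_numElt (lt_le_trans (ltNyr 0) d0) (le_lt_trans d1 (ltry 1)).
split=> //; first by rewrite -!lee_fin -dE d0 d1.
move=> x y Ax Ay; rewrite -lee_fin -dE /diam le_max; apply/orP; right.
by apply: ereal_sup_ubound; exists x => //; exists y.
Qed.

(** Passing to a larger exponent s' makes it positive, so that sets of diameter 0
    do not contribute; since the diameter is at most 1, the power decreases. *)
Lemma powR_le_hausdorff_weight (T : Type) (dist : T -> T -> R) (s s' : R)
    (A : set T) : 0 <= s < s' -> (diam dist A <= 1)%E ->
  ((fine (diam dist A) `^ s')%:E <= hausdorff_weight dist s A)%E.
Proof.
move=> /andP[s0 ss'] /[dup] d1 /fine_diam[dE /andP[f0 f1] _].
have sn0 : s' != 0 by rewrite gt_eqF // (le_lt_trans s0).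
rewrite /hausdorff_weight; case: eqP => [A0|_].
  have -> : diam dist A = 0%E.
    rewrite /diam A0 (_ : [set _ | _ in _ & _ in _] = set0); last first.
      by apply/seteqP; split => z // [].
    by rewrite ereal_sup0; apply/max_idPl.
  by rewrite /= powR0.
rewrite dE poweR_EFin lee_fin /=; move: f0; rewrite le_eqVlt => /predU1P[<-|f0].
  by rewrite powR0 // powR_ge0.
by apply: ger_powR; rewrite ?f0 // ltW.
Qed.

(** A non-contracting map pulls covers of S back to covers of the [inhom_bad]
    numbers with no larger diameters. If the s-dimensional measure of S vanished
    for some s < 1, S would have covers of arbitrarily small weight. *)
Lemma hausdorff_dim_ge1 (th : R) (iota : R -> R * R) (S : set (R * R)) :
  (forall x y, `|x - y| <= dist2 (iota x) (iota y)) ->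
  (forall x, inhom_bad th x -> S (iota x)) ->
  (1%:E <= hausdorff_dim (@dist2 R) S)%E.
Proof.
move=> iota_dist badS; apply/ereal_infP => _ [s [s0 sS] <-].
rewrite lee_fin leNgt; apply/negP => s1.
have [||eps eps0 avoid] := @inhom_bad_avoids_light_cover R th ((1 + s) / 2).
- by lra.
- by lra.
have : (hausdorff_content (@dist2 R) s 1 S < eps%:E)%E.
  apply: (@le_lt_trans _ _ 0%E); last by rewrite lte_fin.
  by rewrite -sS; apply: ereal_sup_ubound; exists 1 => //=.
move=> /ereal_inf_lt[_ [F [SF dF] <-] ltF].
have [|||x xb xF] := avoid (fun i => iota @^-1` F i)
  (fun i => fine (diam (@dist2 R) (F i))).
- by move=> i; have [_ /andP[]] := fine_diam (dF i).
- move=> i x y Fx Fy; have [_ _ h] := fine_diam (dF i).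
  exact: le_trans (iota_dist x y) (h _ _ Fx Fy).
- apply: le_lt_trans ltF; apply: lee_nneseries => [i _ _|i _].
    by rewrite lee_fin powR_ge0.
  by apply: powR_le_hausdorff_weight => //; lra.
have [i _ Fi] := SF _ (badS _ xb).
exact: xF Fi.
Qed.

Lemma dense_prod (A B : set R) (S : set (R * R)) :
  (forall x y, x < y -> exists2 t, x < t < y & A t) ->
  (forall x y, x < y -> exists2 t, x < t < y & B t) ->
  (forall x y, A x -> B y -> S (x, y)) -> dense S.
Proof.
move=> dA dB AB O [[x y] Oxy] oO.
have /nbhs_ballP[e /= e0 eO] : nbhs (x, y) O by apply: open_nbhs_nbhs.
have [|t /andP[t1 t2] At] := dA x (x + e); first by rewrite ltrDl.
have [|u /andP[u1 u2] Bu] := dB y (y + e); first by rewrite ltrDl.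
exists (t, u); split; last exact: AB.
by apply: eO; split; rewrite /ball /= ltr_norml; lra.
Qed.
End Dimension.

Theorem theorem1p1 (R : realType) (theta1 theta2 : R)
    (htheta : theta1 \isn't a Num.int \/ theta2 \isn't a Num.int) :
  exists S : set (R * R)%type,
    [/\ dense S,
        (1%:E <= hausdorff_dim (@dist2 R) S)%E &
        forall xi zeta : R, S (xi, zeta) ->
          let f := mult_form theta1 theta2 xi zeta in
          liminf_pos (fun Q => Q%:R%:E * min_upto f Q)%E
            = liminf_pos (fun q => (q%:R * f q)%:E) /\
          (0 < liminf_pos (fun q => (q%:R * f q)%:E))%E].
Proof.
(* All points with a positive lower bound; the density and the dimension of S
   come from the products of a [uniformly_far] and an [inhom_bad] number. *)
pose S : set (R * R) := [set p | exists2 c, 0 < c & forall q, (0 < q)%N ->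
  c <= q%:R * mult_form theta1 theta2 p.1 p.2 q].
have S1 x y : uniformly_far theta1 x -> inhom_bad theta2 y -> S (x, y).
  move=> [c c0 hc] [c' c0' hc']; exists (c * c') => [|q q0]; first exact: mulr_gt0.
  by rewrite /mult_form /= mulrCA ler_pM ?(ltW c0) ?(ltW c0') ?hc'.
have S2 x y : inhom_bad theta1 x -> uniformly_far theta2 y -> S (x, y).
  move=> [c c0 hc] [c' c0' hc']; exists (c * c') => [|q q0]; first exact: mulr_gt0.
  by rewrite /mult_form /= mulrA ler_pM ?(ltW c0) ?(ltW c0') ?hc.
exists S; split; last first.
- by move=> xi zeta [c c0 hc] f; exact: limn_einf_min_upto c0 hc.
- have [h|h] := htheta.
    have [x _ hx] := uniformly_far_dense h (@ltr01 R).
    apply: (@hausdorff_dim_ge1 R theta2 (fun y => (x, y))) => [y y'|y yb].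
      by case: (le_dist2 (x, y) (x, y')).
    exact: S1.
  have [y _ hy] := uniformly_far_dense h (@ltr01 R).
  apply: (@hausdorff_dim_ge1 R theta1 (fun x => (x, y))) => [x x'|x xb].
    by case: (le_dist2 (x, y) (x', y)).
  exact: S2.
- have [h|h] := htheta.
    apply: dense_prod S1 => x y xy; first exact: uniformly_far_dense.
    exact: inhom_bad_dense.
  apply: dense_prod S2 => x y xy; first exact: inhom_bad_dense.
  exact: uniformly_far_dense.
Qed.
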